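(* Let $m\in\mathbb{N}$ be given and $1\le\ell\le m$. Let the framelet $\psi_\ell^{(m)}$ be defined by its Fourier transform $$\hat{\psi}_\ell^{(m)}(\omega)=i^\ell e^{-\frac{i\omega j_m}{2}}\sqrt{\binom{m}{\ell}}\;\frac{\cos^{m-\ell}(\omega/4)\,\sin^{m+\ell}(\omega/4)}{(\omega/4)^m}.$$ Set $$\Xi_{m,\ell}:=[\underbrace{1,\ldots,1}_{m-\ell},\underbrace{\tfrac12,\ldots,\tfrac12}_{2\ell}].$$ Then $$\psi_\ell^{(m)}(x)=\sqrt{\binom{m}{\ell}}\cdot\frac{1}{4^\ell}\cdot\frac{d^\ell}{dx^\ell}B\left(x-\frac{j_m}{2}\,\Big|\,\Xi_{m,\ell}\right).$$ In particular, $\psi_m^{(m)}$ is the $m$-order derivative of $B_{2m}(2\cdot-j_m)/4^m$, where $B_{2m}$ is the B-spline of order $2m$.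
   Context: The Fourier transform is $\hat f(\omega)=\int_{-\infty}^{\infty} f(x)e^{-i\omega x}\,dx$. Put $j_m:=0$ if $m$ is even and $j_m:=1$ if $m$ is odd. For a matrix $\Xi\in\mathbb{R}^{1\times n}$, the (univariate) box spline $B(\cdot|\Xi)$ is the distribution given by the rule $\int_{\mathbb{R}}B(x|\Xi)\varphi(x)\,dx=\int_{[-1/2,1/2)^n}\varphi(\Xi u)\,du$ for all test functions $\varphi\in\mathscr{D}(\mathbb{R})$. $B_n$ denotes the centered B-spline of order $n$, i.e. the function with Fourier transform $\left(\frac{\sin(\omega/2)}{\omega/2}\right)^{n}$ (value $1$ at $\omega=0$).
   Formalization: The ''In particular'' clause is corrected by a factor 2: ψ_m^{(m)} is the m-order derivative of 2·B_{2m}(2·−j_m)/4^m; the printed constant 1/4^m gives only half of ψ (for m=1, slopes ±1/2 instead of ±1). *)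

(* Defs.v *)
From mathcomp Require Import all_boot all_order all_algebra.
From mathcomp Require Import complex.
From mathcomp Require Import all_classical all_reals all_analysis.

Set Implicit Arguments.
Unset Strict Implicit.
Unset Printing Implicit Defensive.

Import Order.TTheory GRing.Theory Num.Theory.
Import numFieldNormedType.Exports.

Local Open Scope classical_set_scope.
Local Open Scope complex_scope.
Local Open Scope ring_scope.

Section Defs.
Variable R : realType.
Local Notation mu := (@lebesgue_measure R).

Definition cRe (f : R -> R[i]) : R -> R := fun x => complex.Re (f x).
Definition cIm (f : R -> R[i]) : R -> R := fun x => complex.Im (f x).

Definition Cintegrable (f : R -> R[i]) : Prop :=
  mu.-integrable setT (EFin \o cRe f) /\ mu.-integrable setT (EFin \o cIm f).

Definition Cintegral (D : set R) (f : R -> R[i]) : R[i] :=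
  (\int[mu]_(x in D) cRe f x) +i* (\int[mu]_(x in D) cIm f x).

Definition expi (t : R) : R[i] := cos t +i* sin t.

Definition fourier (f : R -> R[i]) (w : R) : R[i] :=
  Cintegral setT (fun x => f x * expi (- (w * x))).

Definition smooth (f : R -> R) : Prop := forall k x, derivable (derive1n k f) x 1.

Definition test_function (phi : R -> R[i]) : Prop :=
  [/\ smooth (cRe phi), smooth (cIm phi)
    & compact (closure [set x | phi x != 0])].

Definition Cderive (k : nat) (phi : R -> R[i]) : R -> R[i] :=
  fun x => derive1n k (cRe phi) x +i* derive1n k (cIm phi) x.

(* Distributions are represented by their pairings T phi.  Only the values on
   test functions are meaningful, so equality is [distr_eq], not [=]. *)
Definition distribution : Type := (R -> R[i]) -> R[i].

Definition distr_eq (S T : distribution) : Prop :=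
  forall phi, test_function phi -> S phi = T phi.

Definition distr_of_fun (f : R -> R[i]) : distribution :=
  fun phi => Cintegral setT (fun x => f x * phi x).

Definition distr_scale (c : R) (T : distribution) : distribution :=
  fun phi => c%:C * T phi.

(* T(x - a) *)
Definition distr_shift (a : R) (T : distribution) : distribution :=
  fun phi => T (fun x => phi (x + a)).

Definition distr_derive (k : nat) (T : distribution) : distribution :=
  fun phi => (-1) ^+ k * T (Cderive k phi).

(* The integral over [-1/2, 1/2)^n, written as the n-fold iterated integral
   (the integrands below are continuous, so this is the integral with respect
   to Lebesgue measure on R^n). *)
Fixpoint cube_integral (n : nat) : ('cV[R]_n -> R[i]) -> R[i] :=
  match n with
  | 0 => fun F => F 0
  | n'.+1 => fun F =>
      Cintegral `[- (1 / 2), 1 / 2[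
        (fun t => cube_integral (fun u : 'cV[R]_n' =>
           F (col_mx (t%:M : 'cV[R]_1) u)))
  end.

Definition box_spline (n : nat) (Xi : 'rV[R]_n) : distribution :=
  fun phi => cube_integral (fun u : 'cV[R]_n => phi ((Xi *m u) 0 0)).

Definition Xi (m l : nat) : 'rV[R]_((m - l) + 2 * l) :=
  row_mx (const_mx 1) (const_mx (1 / 2)).

Definition j_ (m : nat) : R := (odd m)%:R.

(* As l >= 1 and m >= 1, the right-hand side extends continuously by 0 at
   w = 0, which is the value given there by the convention 0^-1 = 0. *)
Definition is_framelet (m l : nat) (psi : R -> R[i]) : Prop :=
  Cintegrable psi /\
  forall w : R, fourier psi w =
    (0 +i* 1) ^+ l * expi (- (w * j_ m / 2)) * (Num.sqrt ('C(m, l)%:R : R))%:C *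
    (cos (w / 4) ^+ (m - l) * sin (w / 4) ^+ (m + l) / (w / 4) ^+ m)%:C.

(* The centered B-spline B_n, which has integral 1.  Hence x |-> B_n (2 x - a)
   has integral 1/2, whereas a box spline has mass 1: as distributions,
   B(x - a/2 | [1/2, ..., 1/2]) = 2 B_n (2 x - a). *)
Definition is_bspline (n : nat) (B : R -> R[i]) : Prop :=
  Cintegrable B /\
  forall w : R, fourier B w =
    ((if w == 0 then 1 else sin (w / 2) / (w / 2)) ^+ n)%:C.

End Defs.

(* Main.v *)
Require Import Defs.
From mathcomp Require Import all_boot all_order all_algebra.
From mathcomp Require Import complex.
From mathcomp Require Import all_classical all_reals all_analysis.
From mathcomp Require Import measurable_realfun.
From mathcomp Require Import ring lra.

Set Implicit Arguments.
Unset Strict Implicit.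
Unset Printing Implicit Defensive.

Import Order.TTheory GRing.Theory Num.Theory.
Import numFieldNormedType.Exports.

Local Open Scope classical_set_scope.
Local Open Scope complex_scope.
Local Open Scope ring_scope.

(* A trigonometric polynomial approximation of bounded continuous functions, by
   discrete convolution with the de la Vallee Poussin kernel on [-L, L] with L
   tending to infinity, is pointwise and uniformly bounded on the whole line.
   Hence a linear functional that is continuous for bounded pointwise
   convergence and kills all cos(w x) and sin(w x) vanishes on all bounded
   continuous functions.  This gives uniqueness of the Fourier transform when an
   integrable function is compared with the box spline side.

   That side is of order 0 although it contains l derivatives: pairing with a box
   spline iterates the averages g |-> int_{-1/2}^{1/2} g(x + a t) dt, and the
   average of g' is the difference quotient (g(x + a/2) - g(x - a/2)) / a, so l of
   the 2 l averages with a = 1/2 absorb the l derivatives.  Exponentials are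
   eigenfunctions of averages and difference quotients, and the product of the
   eigenvalues is the Fourier transform defining the framelet. *)

(** * Equispaced sums of the de la Vallee Poussin kernel *)

Section Trigonometry.
Variable R : realType.
Implicit Types (t : R) (n N : nat).

Lemma expiD s t : expi (s + t) = expi s * expi t :> R[i].
Proof. by rewrite /expi cosD sinD; simpc; congr Complex; rewrite addrC. Qed.

Lemma expi0 : expi 0 = 1 :> R[i].
Proof. by rewrite /expi cos0 sin0. Qed.

Lemma expiX t n : expi t ^+ n = expi (n%:R * t).
Proof.
elim: n => [|n IH]; first by rewrite mul0r expi0.
by rewrite exprS IH -expiD mulrSr mulrDl mul1r addrC.
Qed.

Lemma complexRe_sum (I : Type) (r : seq I) (F : I -> R[i]) :
  complex.Re (\sum_(i <- r) F i) = \sum_(i <- r) complex.Re (F i).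
Proof.
elim: r => [|i r IH]; first by rewrite !big_nil.
by rewrite !big_cons -IH; case: (F i) => a b; case: (\sum_(_ <- _) _).
Qed.

(* The de la Vallee Poussin kernel of degree [n], up to normalisation. *)
Definition vp n t : R := ((1 + cos t) / 2) ^+ n.

(** The mean over a period of [vp n t], which is the [2n]-th power of [cos (t / 2)]. *)
Definition vp_mean n : R := 'C(n.*2, n)%:R / 4 ^+ n.

Lemma vp_ge0 n t : 0 <= vp n t.
Proof. by apply: exprn_ge0; have := cos_geN1 t; lra. Qed.

Lemma vp_mean_gt0 n : 0 < vp_mean n.
Proof. by rewrite divr_gt0 ?exprn_gt0// ltr0n bin_gt0 -addnn leq_addr. Qed.

(** Consecutive central binomial coefficients have ratio [2 (2n + 1) / (n + 1)]. The relative loss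
    [1 / (2 (n + 1))] is what yields the rate of approximation in [sum_vp_cos_node]. *)
Lemma vp_meanS n : vp_mean n.+1 = vp_mean n * (1 - (2 * n.+1%:R)^-1).
Proof.
have h : ('C(n.+1.*2, n.+1) * n.+1 = 2 * n.*2.+1 * 'C(n.*2, n))%N.
  have e1 := mul_bin_diag n.*2.+2 n; have e2 := mul_bin_down n.*2.+1 n.
  rewrite /= in e1 e2; rewrite doubleS mulnC -e1.
  have e3 : (n.*2.+1 - n = n.+1)%N by rewrite -addnn -addnS addKn.
  rewrite e3 in e2.
  by rewrite -mulnA e2 mulnA mul2n doubleS.
have h' : 'C(n.+1.*2, n.+1)%:R * n.+1%:R = 2 * n.*2.+1%:R * 'C(n.*2, n)%:R :> R.
  by rewrite -!natrM h.
have n0 : n.+1%:R != 0 :> R by rewrite pnatr_eq0.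
rewrite /vp_mean exprS; apply: (mulfI n0).
rewrite mulrA [n.+1%:R * _]mulrC h' -addnn -addSn natrD mulrSr; field.
by rewrite expf_neq0 ?pnatr_eq0// andbT addrC natr1.
Qed.

(** Since [2 + 2 cos t = e^(-it) (1 + e^(it))^2], the binomial theorem expands the [n]-th power, and
    taking real parts leaves cosines. *)
Lemma vpE n t : vp n t =
  4^-1 ^+ n * \sum_(j < n.*2.+1) 'C(n.*2, j)%:R * cos ((j%:R - n%:R) * t).
Proof.
have h1 : expi (- t) * (1 + expi t) ^+ 2 = (2 + 2 * cos t)%:C.
  have ee : expi (- t) * expi t = 1 by rewrite -expiD addNr expi0.
  rewrite [LHS](_ : _ = expi (- t) + (2 + expi t) * (expi (- t) * expi t)); last by ring.
  rewrite ee mulr1 /expi cosN sinN -[2]/(2%:R) -[2%:R in LHS](rmorph_nat (real_complex R)).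
  by simpc; congr Complex; ring.
have h2 : (4 ^+ n * vp n t)%:C = expi (- (n%:R * t)) * (1 + expi t) ^+ n.*2.
  rewrite -exprMn [4 * _](_ : _ = 2 + 2 * cos t); last by field.
  by rewrite rmorphXn/= -h1 exprMn expiX -exprM mul2n mulrN.
have h3 : 4 ^+ n * vp n t = complex.Re (4 ^+ n * vp n t)%:C by [].
apply: (@mulfI _ (4 ^+ n)); first by rewrite expf_neq0.
rewrite [RHS]mulrA -[in RHS]exprMn divff// expr1n mul1r h3 h2 exprDn.
rewrite mulr_sumr complexRe_sum; apply: eq_bigr => j _.
rewrite expr1n mul1r expiX mulrnAr -expiD [- _ + _]addrC -mulrBl.
by rewrite -mulr_natl /expi -(rmorph_nat (real_complex R)); simpc.
Qed.

(** With [a = pi d / N], multiplication by [2 sin a] makes the sum telescope, and its two ends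
    differ by [d] full periods. As [0 < d < N], the angle [a] lies strictly between 0 and [pi], so
    [sin a] is nonzero. *)
Lemma sum_cos_equispaced N d t : (0 < d < N)%N ->
  \sum_(k < N) cos (t + d%:R * (2 * pi * k%:R / N%:R)) = 0.
Proof.
case/andP=> d0 dN; have N0 : (0 < N)%N by apply: leq_ltn_trans dN.
have Nn : N%:R != 0 :> R by rewrite pnatr_eq0 -lt0n.
set a : R := d%:R * (pi / N%:R).
have sa : sin a != 0.
  rewrite gt_eqF// sin_gt0_pi// mulr_gt0 ?ltr0n//= ?divr_gt0 ?pi_gt0 ?ltr0n//.
  by rewrite /a mulrA ltr_pdivrMr ?ltr0n// mulrC ltr_pM2l ?pi_gt0// ltr_nat.
apply: (@mulfI _ (2 * sin a)); first by rewrite mulf_neq0.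
rewrite mulr0 mulr_sumr.
pose f k : R := sin (t - a + k%:R * (2 * a)).
under eq_bigr => k _.
  rewrite (_ : 2 * sin a * cos _ = f k.+1 - f k); first over.
  rewrite /f -natr1 mulrDl mul1r.
  rewrite [X in cos X](_ : _ = t + k%:R * (2 * a)); last by rewrite /a; field.
  rewrite [t - a + _](_ : _ = (t + k%:R * (2 * a)) + a); last by ring.
  rewrite [t - a + _](_ : _ = (t + k%:R * (2 * a)) - a); last by ring.
  by rewrite sinD sinB; ring.
rewrite -(big_mkord xpredT (fun k => f k.+1 - f k)) telescope_sumr// /f.
rewrite mul0r addr0 [N%:R * _](_ : _ = (pi *+ 2) *+ d); last first.
  by rewrite /a -[RHS]mulr_natr -[pi *+ 2]mulr_natr; field.
have per u i : sin (u + (pi *+ 2) *+ i) = sin u :> R.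
  by elim: i => [|i IH]; rewrite ?mulr0n ?addr0// mulrSr addrA sinD2pi.
by rewrite per subrr.
Qed.

(** The frequencies [j - n] in [vpE] have modulus at most [n < N], so equispaced summation kills all
    of them except the constant term [j = n]. *)
Lemma sum_vp_equispaced N n t : (n < N)%N ->
  \sum_(k < N) vp n (t + 2 * pi * k%:R / N%:R) = N%:R * vp_mean n.
Proof.
move=> nN; under eq_bigr => k _ do rewrite vpE.
rewrite -mulr_sumr exchange_big/=.
have nn : (n < n.*2.+1)%N by rewrite ltnS -addnn leq_addr.
rewrite (bigD1 (Ordinal nn))//= [X in _ + X]big1 ?addr0 => [|j jn].
  rewrite -mulr_sumr subrr; under eq_bigr do rewrite mul0r cos0.
  by rewrite sumr_const card_ord /vp_mean exprVn; ring.
rewrite -mulr_sumr; apply/eqP; rewrite mulf_eq0; apply/orP; right; apply/eqP.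
have {}jn : nat_of_ord j != n by apply: contra_neq jn => h; apply: val_inj.
have jn2 : (j <= n.*2)%N by rewrite -ltnS.
have [jln|njl|e] := ltngtP j n; last by rewrite e eqxx in jn.
(* A negative frequency is replaced by its opposite, cosine being even. *)
- rewrite -[RHS](@sum_cos_equispaced N (n - j) ((n - j)%:R * t)).
    apply: eq_bigr => k _; rewrite -mulrDr -[RHS]cosN natrB 1?ltnW// -mulNr.
    by rewrite opprB.
  by rewrite subn_gt0 jln/= (leq_ltn_trans _ nN)// leq_subr.
- rewrite -[RHS](@sum_cos_equispaced N (j - n) ((j - n)%:R * t)).
    by apply: eq_bigr => k _; rewrite -mulrDr natrB 1?ltnW.
  by rewrite subn_gt0 njl/= (leq_ltn_trans _ nN)// leq_subLR addnn.
Qed.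

End Trigonometry.

(** * Approximation by positive trigonometric sums on growing intervals *)

Section TrigonometricApproximation.
Variable R : realType.
Implicit Types (L x : R) (n N : nat) (g : R -> R).

Definition node L N k : R := L * (2 * k%:R / N%:R - 1).

(** For nonzero [L] the weights have sum 1. With [n.+2] nodes the equispaced sums are exact for both
    [vp n] and [vp n.+1], as [sum_vp_cos_node] requires. *)
Definition vpsum L n g x : R :=
  (n.+2%:R * vp_mean R n)^-1 *
  \sum_(k < n.+2) g (node L n.+2 k) * vp n (pi * (node L n.+2 k - x) / L).

Lemma node_itv L N k : 0 < L -> (k <= N)%N -> - L <= node L N k <= L.
Proof.
move=> L0 kN; have [->|N0] := posnP N.
  by rewrite /node invr0 mulr0 add0r mulrN1 lexx/= ge0_cp// ltW.
have h0 : 0 <= k%:R / N%:R :> R by rewrite divr_ge0.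
have h1 : k%:R / N%:R <= 1 :> R by rewrite ler_pdivrMr ?ltr0n// mul1r ler_nat.
rewrite /node -mulrA; move: (_ / _) h0 h1 => q q0 q1.
by apply/andP; split; nra.
Qed.

Lemma sum_vp_node L n N x : L != 0 -> (n < N)%N ->
  \sum_(k < N) vp n (pi * (node L N k - x) / L) = N%:R * vp_mean R n.
Proof.
move=> L0 nN; rewrite -(@sum_vp_equispaced R N n (- pi * (L + x) / L) nN).
have N0 : N%:R != 0 :> R by rewrite pnatr_eq0 -lt0n (leq_ltn_trans _ nN).
by apply: eq_bigr => k _; congr vp; rewrite /node; field; rewrite N0.
Qed.

(** As [1 - cos = 2 - 2 (1 + cos) / 2], each summand is [2 vp n - 2 vp n.+1], and [vp_meanS] gives
    the gap between the two means. *)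
Lemma sum_vp_cos_node L n N x : L != 0 -> (n.+1 < N)%N ->
  \sum_(k < N) vp n (pi * (node L N k - x) / L) *
               (1 - cos (pi * (node L N k - x) / L)) =
  N%:R * vp_mean R n / n.+1%:R.
Proof.
move=> L0 nN.
under eq_bigr => k _.
  rewrite (_ : _ * _ = 2 * vp n (pi * (node L N k - x) / L) -
                      2 * vp n.+1 (pi * (node L N k - x) / L)); first over.
  by rewrite /vp exprS; field.
rewrite sumrB -!mulr_sumr !sum_vp_node// 1?ltnW// vp_meanS.
have N0 : n.+1%:R != 0 :> R by rewrite pnatr_eq0.
by move: N0; move: (n.+1%:R) => a a0; field.
Qed.

Lemma vpsum_den_gt0 n : 0 < n.+2%:R * vp_mean R n.
Proof. by rewrite mulr_gt0 ?ltr0n// vp_mean_gt0. Qed.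

(** The sum is a convex combination of values of [g]. *)
Lemma normr_vpsum_le L n g x M : 0 < L -> (forall y, `|g y| <= M) ->
  `|vpsum L n g x| <= M.
Proof.
move=> L0 gM; have D0 := vpsum_den_gt0 n.
rewrite /vpsum normrM gtr0_norm ?invr_gt0// ler_pdivrMl//.
apply: le_trans (ler_norm_sum _ _ _) _.
rewrite -(@sum_vp_node L n n.+2 x (lt0r_neq0 L0) _)// mulr_suml.
by apply: ler_sum => k _; rewrite normrM mulrC ger0_norm ?vp_ge0// ler_wpM2l ?vp_ge0.
Qed.

(* Korovkin's argument: the nodal operator is positive, reproduces constants,
   and maps [1 - cos] centred at [x] to [1 / n.+1]. *)
Lemma vpsum_approx L n g x e K : 0 < L ->
  (forall y, - L <= y <= L ->
     `|g y - g x| <= e + K * (1 - cos (pi * (y - x) / L))) ->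
  `|vpsum L n g x - g x| <= e + K / n.+1%:R.
Proof.
move=> L0 gK; have D0 := vpsum_den_gt0 n; have L0' := lt0r_neq0 L0.
rewrite -[X in _ - X](mulKf (lt0r_neq0 D0)) /vpsum -mulrBr.
rewrite normrM gtr0_norm ?invr_gt0// ler_pdivrMl//.
set v := fun k => vp n (pi * (node L n.+2 k - x) / L).
set c := fun k => 1 - cos (pi * (node L n.+2 k - x) / L).
have sv : \sum_(k < n.+2) v k = n.+2%:R * vp_mean R n by exact: sum_vp_node.
have svc : \sum_(k < n.+2) v k * c k = n.+2%:R * vp_mean R n / n.+1%:R.
  exact: sum_vp_cos_node.
rewrite mulrDr [_ * (K / _)](_ : _ = K * (n.+2%:R * vp_mean R n / n.+1%:R)); last by ring.
rewrite -svc -sv !mulr_suml mulr_sumr -sumrB -big_split/=.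
apply: le_trans (ler_norm_sum _ _ _) _; apply: ler_sum => k _.
have v0 : 0 <= v k by exact: vp_ge0.
rewrite [g _ * _]mulrC -mulrBr normrM ger0_norm//.
rewrite [K * _]mulrCA -mulrDr ler_wpM2l//; apply: gK.
by apply: node_itv => //; exact: ltnW.
Qed.

(* Degree making the error of [vpsum] at most [2 M / L] away from the
   [1 / L]-neighbourhood of the point. *)
Definition vp_degree L : nat := Num.truncn (L / (1 - cos (pi / L ^+ 2))).

(** Cosine decreases up to [pi]; from there to [3 pi / 2] it is nonpositive, while
    [pi / L ^+ 2 <= pi / 4] has nonnegative cosine. The upper limit is the largest angle between a
    node in [[-L, L]] and a point of modulus at most [L / 2]. *)
Lemma cos_le_away L t : 2 <= L -> pi / L ^+ 2 <= `|t| <= pi * 3 / 2 ->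
  cos t <= cos (pi / L ^+ 2).
Proof.
move=> L2 /andP[t1 t2]; rewrite -[cos t]cos_norm.
have pi0 := pi_gt0 R.
have L4 : 4 <= L ^+ 2 by nra.
have p4 : pi / L ^+ 2 <= pi / 4.
  by rewrite ler_pM2l// lef_pV2 ?posrE//; lra.
have p0 : 0 < pi / L ^+ 2 by rewrite divr_gt0//; lra.
have [tp|tp] := leP `|t| pi.
  move: t1; rewrite le_eqVlt => /predU1P[->//|t1].
  by apply/ltW; rewrite ltr_cos// in_itv/= ?normr_ge0//; lra.
apply: (@le_trans _ _ 0); last by apply: cos_ge0_pihalf; lra.
rewrite -[`|t|](subrK pi) cosDpi oppr_le0.
by apply: cos_ge0_pihalf; lra.
Qed.

(** Near [x] continuity controls the error; elsewhere the crude bound [2 M] is charged to [1 - cos].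
    The choice [L = i.+2] ensures [2 <= L]. *)
Lemma vpsum_cvg g x M : {for x, continuous g} -> (forall y, `|g y| <= M) ->
  (fun i => vpsum (i.+2%:R) (vp_degree i.+2%:R) g x) @ \oo --> g x.
Proof.
move=> gx gM; have M0 : 0 <= M := le_trans (normr_ge0 _) (gM 0).
apply/cvgrPdist_le => e e0.
have e2 : 0 < e / 2 by lra.
have /cvgrPdist_le/(_ _ e2)/nbhs_ballP[d /= d0 hd] := gx.
(* Once [L] exceeds [r], the three summands give [L^-1 <= d], [2 |x| <= L] and
   [2 M / L <= e / 2]. *)
pose r := d^-1 + 2 * `|x| + 4 * M / e.
near=> i.
have ri : r <= i%:R by near: i; exact: nbhs_infty_ger.
have dV0 : 0 < d^-1 by rewrite invr_gt0.
have Me : 0 <= 4 * M / e by rewrite divr_ge0 ?(ltW e0)// mulr_ge0.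
have x0 : 0 <= `|x| by [].
rewrite /r in ri; set L : R := i.+2%:R.
have iL : i%:R = L - 2 by rewrite /L -addn2 natrD addrK.
rewrite {}iL in ri.
have L2 : 2 <= L by rewrite /L ler_nat.
have L0 : 0 < L by lra.
have Ld : L^-1 <= d by rewrite -[d]invrK lef_pV2 ?posrE//; lra.
have Lx : 2 * `|x| <= L by lra.
have LM : 2 * M / L <= e / 2.
  have : 4 * M / e <= L by lra.
  by rewrite ler_pdivrMr// => h; rewrite ler_pdivrMr//; nra.
set q := 1 - cos (pi / L ^+ 2).
have pi0 := pi_gt0 R.
have q0 : 0 < q.
  rewrite subr_gt0 -[ltRHS](@cos0 R) ltr_cos ?in_itv/= ?lexx ?(ltW pi0)//.
    by rewrite divr_gt0 ?exprn_gt0.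
  rewrite divr_ge0 ?sqr_ge0 ?(ltW pi0)//= ler_pdivrMr ?exprn_gt0//.
  by rewrite ler_peMr ?(ltW pi0)// expr_ge1//; lra.
rewrite distrC.
(* The constant is [K = 2 M / q] because [1 - cos] is at least [q] at distance [d] or more from
   [x]. *)
apply: (@le_trans _ _ (e / 2 + (2 * M / q) / (vp_degree L).+1%:R)).
  apply: vpsum_approx => // y /andP[y1 y2].
  have c1 := cos_le1 (pi * (y - x) / L).
  have K0 : 0 <= 2 * M / q by rewrite divr_ge0 ?(ltW q0)// mulr_ge0.
  have [yx|yx] := ltP `|y - x| d.
    have := hd y; rewrite /ball/= distrC => /(_ yx); rewrite distrC => h.
    by rewrite -[leLHS]addr0 lerD// mulr_ge0// subr_ge0.
  have tE : `|pi * (y - x) / L| = pi * `|y - x| / L.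
    by rewrite !normrM normfV (gtr0_norm pi0) (gtr0_norm L0).
  have h1 : pi / L ^+ 2 <= `|pi * (y - x) / L| <= pi * 3 / 2.
    have yx' : `|y - x| <= L * (3 / 2).
      apply: le_trans (ler_normB _ _) _.
      have : `|y| <= L by rewrite ler_norml y1.
      lra.
    rewrite tE; apply/andP; split.
      rewrite expr2 invfM mulrA ler_pM2r ?invr_gt0// ler_pM2l//.
      exact: le_trans yx.
    by rewrite ler_pdivrMr//; nra.
  have h2 : q <= 1 - cos (pi * (y - x) / L) by rewrite lerB// cos_le_away.
  apply: (@le_trans _ _ (2 * M)).
    by apply: le_trans (ler_normB _ _) _; rewrite mulr_natl mulr2n lerD.
  rewrite -[leLHS]add0r lerD ?(ltW e2)//.
  rewrite -[leLHS](divfK (lt0r_neq0 q0)) ler_wpM2l//.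
(* The degree is the integer part of [L / q], so the second error term is at most [2 M / L]. *)
have h3 : L / q <= (vp_degree L).+1%:R by exact/ltW/truncnS_gt.
have h4 : 2 * M / q / (vp_degree L).+1%:R <= 2 * M / L.
  rewrite ler_pdivrMr ?ltr0n//; apply: le_trans (_ : 2 * M / L * (L / q) <= _).
    by rewrite mulrA divfK ?gt_eqF.
  by rewrite ler_wpM2l// divr_ge0 ?(ltW L0)// mulr_ge0.
by rewrite [leRHS](splitr e) lerD// (le_trans h4).
Unshelve. all: by end_near. Qed.

End TrigonometricApproximation.

(** * Functionals continuous for bounded pointwise convergence *)

Section BoundedPointwise.
Variable R : realType.
Implicit Types (g h : R -> R) (mu : (R -> R) -> R) (U V : (R -> R) -> R -> R).

Definition bcont g := continuous g /\ exists M, forall x, `|g x| <= M.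

Definition bpcvg0 (g_ : nat -> R -> R) :=
  [/\ forall i, continuous (g_ i), exists M, forall i x, `|g_ i x| <= M
    & forall x, g_ ^~ x @ \oo --> (0 : R)].

(* The functionals integrating against a finite signed measure, expressed
   without measures. *)
Definition bp_functional mu :=
  (forall (a : R) g h, bcont g -> bcont h ->
     mu (fun x => a * g x + h x) = a * mu g + mu h) /\
  (forall g_ : nat -> R -> R, bpcvg0 g_ -> mu (g_ i) @[i --> \oo] --> (0 : R)).

(** This class is closed under composition, and evaluation at a point turns each member into a
    [bp_functional]. *)
Definition bp_operator U :=
  [/\ forall g, bcont g -> bcont (U g),
      forall (a : R) g h, bcont g -> bcont h ->
        U (fun x => a * g x + h x) = (fun x => a * U g x + U h x)
    & forall g_ : nat -> R -> R, bpcvg0 g_ -> bpcvg0 (fun i => U (g_ i))].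

Lemma bcont_lin (a : R) g h : bcont g -> bcont h -> bcont (fun x => a * g x + h x).
Proof.
move=> [gc [M gM]] [hc [N hN]]; split.
  by move=> x; apply: cvgD; [apply: cvgM; [exact: cvg_cst|exact: gc]|exact: hc].
exists (`|a| * M + N) => x; apply: le_trans (ler_normD _ _) _.
by rewrite lerD// normrM ler_wpM2l.
Qed.

Lemma bcont_cst (a : R) : bcont (fun=> a).
Proof. by split; [move=> x; exact: cvg_cst | exists `|a|]. Qed.

Lemma bcont_comp g (f : R -> R) : continuous f -> bcont g -> bcont (g \o f).
Proof.
move=> fc [gc [M gM]]; split; last by exists M => x; exact: gM.
by move=> x; apply: continuous_comp; [exact: fc|exact: gc].
Qed.

Lemma continuous_affine (a b : R) : continuous (fun x : R => a * x + b).
Proof.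
by move=> x; apply: cvgD; [apply: cvgM; [exact: cvg_cst|exact: cvg_id]|exact: cvg_cst].
Qed.

Lemma bcont_cos : bcont (@cos R).
Proof. by split; [exact: continuous_cos|exists 1; exact: cos_max]. Qed.

Lemma bcont_sin : bcont (@sin R).
Proof. by split; [exact: continuous_sin|exists 1; exact: sin_max]. Qed.

Lemma bcont_cosM (w : R) : bcont (fun x => cos (w * x)).
Proof.
rewrite (_ : (fun _ => _) = cos \o (fun x => w * x + 0)).
  by apply: bcont_comp; [exact: continuous_affine|exact: bcont_cos].
by apply/funext => x /=; rewrite addr0.
Qed.

Lemma bcont_sinM (w : R) : bcont (fun x => sin (w * x)).
Proof.
rewrite (_ : (fun _ => _) = sin \o (fun x => w * x + 0)).
  by apply: bcont_comp; [exact: continuous_affine|exact: bcont_sin].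
by apply/funext => x /=; rewrite addr0.
Qed.

Section Separation.
Variable mu : (R -> R) -> R.
Hypothesis bp_mu : bp_functional mu.
Hypothesis mu_cos : forall w, mu (fun x => cos (w * x)) = 0.
Hypothesis mu_sin : forall w, mu (fun x => sin (w * x)) = 0.

(** A linear subspace; the next lemmas show that it contains every [vpsum]. *)
Let null g := bcont g /\ mu g = 0.

Let null_lin (a : R) g h : null g -> null h -> null (fun x => a * g x + h x).
Proof.
move=> [gb g0] [hb h0]; split; first exact: bcont_lin.
by rewrite bp_mu.1// g0 h0 mulr0 addr0.
Qed.

Let null0 : null (fun=> 0).
Proof.
have b0 := bcont_cst 0; split => //.
have := bp_mu.1 1 _ _ b0 b0; rewrite mulr0 addr0 mul1r => e.
by apply: (@addrI _ (mu (fun=> 0))); rewrite addr0 -e.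
Qed.

Let null_sum (I : Type) (r : seq I) (a : I -> R) (F : I -> R -> R) :
  (forall i, null (F i)) -> null (fun x => \sum_(i <- r) a i * F i x).
Proof.
move=> nF; elim: r => [|i r IH].
  by under eq_fun do rewrite big_nil; exact: null0.
by under eq_fun do rewrite big_cons; exact: null_lin.
Qed.

Let null_cos (a b : R) : null (fun x => cos (a * x + b)).
Proof.
have n0 : null (fun x => - sin b * sin (a * x) + 0).
  by apply: null_lin => //; split; [exact: bcont_sinM|exact: mu_sin].
rewrite (_ : (fun _ => _) =
    fun x => cos b * cos (a * x) + (- sin b * sin (a * x) + 0)).
  by apply: null_lin => //; split; [exact: bcont_cosM|exact: mu_cos].
by apply/funext => x; rewrite cosD addr0; ring.
Qed.

Let null_vp n (a b : R) : null (fun x => vp n (a * x + b)).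
Proof.
under eq_fun do rewrite vpE mulr_sumr.
rewrite (_ : (fun _ => _) = fun x => \sum_(j < n.*2.+1)
    (4^-1 ^+ n * 'C(n.*2, j)%:R) *
    cos ((j%:R - n%:R) * a * x + (j%:R - n%:R) * b)); last first.
  apply/funext => x; apply: eq_bigr => j _; rewrite -[RHS]mulrA; congr (_ * (_ * cos _)).
  by ring.
exact: null_sum.
Qed.

Let null_vpsum L n g : null (vpsum L n g).
Proof.
rewrite (_ : vpsum L n g = fun x => \sum_(k < n.+2)
    ((n.+2%:R * vp_mean R n)^-1 * g (node L n.+2 k)) *
    vp n (- (pi / L) * x + pi * node L n.+2 k / L)); last first.
  apply/funext => x; rewrite /vpsum mulr_sumr; apply: eq_bigr => k _.
  rewrite -[RHS]mulrA; congr (_ * (_ * vp _ _)); ring.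
exact: null_sum.
Qed.

(** The differences between [g] and its trigonometric sums tend to 0 pointwise and are bounded by
    [2 M]. Their images under [mu] all equal [mu g], a constant sequence with limit 0. *)
Lemma bp_functional_eq0 g : bcont g -> mu g = 0.
Proof.
move=> gb; have [gc [M gM]] := gb.
pose T (i : nat) : R -> R := vpsum i.+2%:R (vp_degree (i.+2%:R : R)) g.
have nT i : null (T i) by exact: null_vpsum.
have h1 : mu (fun x => -1 * T i x + g x) @[i --> \oo] --> mu g.
  rewrite (_ : (fun _ => _) = fun=> mu g); first exact: cvg_cst.
  by apply/funext => i; rewrite (bp_mu.1 _ _ _ (nT i).1 gb) (nT i).2 mulr0 add0r.
apply: (@cvg_unique _ (@norm_hausdorff _ R) _ _ _ _ h1).
apply: bp_mu.2; split.
- by move=> i; case: (bcont_lin (-1) (nT i).1 gb).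
- exists (M + M) => i x; apply: le_trans (ler_normD _ _) _.
  by rewrite mulN1r normrN lerD// normr_vpsum_le.
- move=> x; rewrite -[X in _ --> X](addNr (g x)).
  apply: cvgD; last exact: cvg_cst.
  under eq_fun do rewrite mulN1r; apply: cvgN; exact: (vpsum_cvg (gc x) gM).
Qed.

End Separation.
End BoundedPointwise.

(** * Integrals, difference quotients and averages as bounded-pointwise continuous maps *)

Section Averages.
Variable R : realType.
Local Notation mu := (@lebesgue_measure R).
Implicit Types (f g h : R -> R) (a b x : R) (D : set R).

Lemma integrable_mul_bcont D f g : measurable D ->
  mu.-integrable D (EFin \o f) -> bcont g ->
  mu.-integrable D (EFin \o (fun x => f x * g x)).
Proof.
move=> mD fi [gc [M gM]].
rewrite (_ : _ \o _ = (EFin \o f) \* (EFin \o g))%E.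
  apply: integrableMl => //.
    by apply: measurable_funTS; exact: continuous_measurable_fun.
  exists M; split; first exact: num_real.
  by move=> N MN x _ /=; apply: le_trans (gM x) (ltW MN).
by apply/funext => x /=; rewrite EFinM.
Qed.

(** Dominated convergence with the majorant [|f| M]. *)
Lemma bp_functional_Rintegral D f : measurable D ->
  mu.-integrable D (EFin \o f) ->
  bp_functional (fun g => \int[mu]_(x in D) (f x * g x)).
Proof.
move=> mD fi; split.
  move=> a g h gb hb; rewrite -RintegralZl//; last exact: integrable_mul_bcont.
  rewrite -RintegralD//.
  - by apply: eq_Rintegral => x _; ring.
  - rewrite (_ : _ \o _ = EFin \o (fun x => f x * (a * g x + 0))).
      by apply: integrable_mul_bcont => //; apply: bcont_lin => //; exact: bcont_cst.
    by apply/funext => x /=; rewrite addr0 mulrCA.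
  - exact: integrable_mul_bcont.
move=> g_ [gc [M gM] g0].
have mf : measurable_fun D f by apply/measurable_EFinP; exact: measurable_int fi.
have [] := @dominated_convergence _ _ _ mu D mD
  (fun i x => (f x * g_ i x)%:E) (cst 0%E) (fun x => (`|f x| * M)%:E).
- move=> i; apply/measurable_EFinP; apply: measurable_funM => //.
  by apply: measurable_funTS; exact: continuous_measurable_fun.
- exact: measurable_cst.
- apply: aeW => x _ /=; apply: cvg_EFin; first exact: nearW.
  by rewrite /= -[X in _ --> X](mulr0 (f x)); apply: cvgM; [exact: cvg_cst|exact: g0].
- have := @integrable_mul_bcont D (fun x => `|f x|) (cst M) mD.
  by apply; [exact: integrable_norm|exact: bcont_cst].
- by apply: aeW => x i _ /=; rewrite lee_fin normrM ler_wpM2l.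
move=> _ _; rewrite integral0 => h.
by have := fine_cvg h; apply.
Qed.

Lemma bp_functional_lin (m n : (R -> R) -> R) a :
  bp_functional m -> bp_functional n -> bp_functional (fun g => a * m g + n g).
Proof.
move=> [m1 m2] [n1 n2]; split.
  by move=> b g h gb hb; rewrite m1// n1//; ring.
move=> g_ g0; rewrite -[X in _ --> X](addr0 (0 : R)) -[X in X + _](mulr0 a).
by apply: cvgD; [apply: cvgM; [exact: cvg_cst|exact: m2]|exact: n2].
Qed.

Lemma bp_functional_eval (U : (R -> R) -> R -> R) x :
  bp_operator U -> bp_functional (fun g => U g x).
Proof.
move=> [Ub Ulin U0]; split; first by move=> a g h gb hb; rewrite Ulin.
by move=> g_ /U0[_ _]; exact.
Qed.

Lemma bp_operator_comp (U V : (R -> R) -> R -> R) :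
  bp_operator U -> bp_operator V -> bp_operator (U \o V).
Proof.
move=> [Ub Ulin U0] [Vb Vlin V0]; split.
- by move=> g gb; exact/Ub/Vb.
- by move=> a g h gb hb /=; rewrite Vlin// Ulin//; exact: Vb.
- by move=> g_ /V0/U0.
Qed.

Lemma bp_operator_id : @bp_operator R id.
Proof. by split. Qed.

Lemma bp_operator_iter (U : (R -> R) -> R -> R) n :
  bp_operator U -> bp_operator (iter n U).
Proof.
move=> Ub; elim: n => [|n IH]; first exact: bp_operator_id.
exact: (bp_operator_comp Ub IH).
Qed.

Definition diffq a g x := (g (x + a / 2) - g (x - a / 2)) / a.

Lemma bp_operator_diffq a : bp_operator (diffq a).
Proof.
have diffqE g : diffq a g = fun x =>
    a^-1 * (g \o (fun y => 1 * y + a / 2)) x +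
    (- a^-1 * (g \o (fun y => 1 * y + - (a / 2))) x + 0).
  by apply/funext => x; rewrite /diffq /= !mul1r; ring.
have diffq_bcont g : bcont g -> bcont (diffq a g).
  move=> gb; rewrite diffqE.
  do 2?[apply: bcont_lin]; try exact: bcont_cst;
    by apply: bcont_comp => //; exact: continuous_affine.
split=> //.
  by move=> b g h gb hb; apply/funext => x; rewrite /diffq; ring.
move=> g_ [gc [M gM] g0]; split.
- by move=> i; case: (@diffq_bcont (g_ i)) => //; split=> //; exists M.
- exists ((M + M) * `|a^-1|) => i x.
  by rewrite /diffq normrM ler_wpM2r// (le_trans (ler_normB _ _))// lerD.
- move=> x; rewrite -[X in _ --> X](mul0r a^-1) -[X in X * _](subr0 0).
  by apply: cvgM; [apply: cvgB; exact: g0|exact: cvg_cst].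
Qed.

Local Notation cube1 := (`[- (1 / 2), 1 / 2[%classic : set R).

(** The effect on a test function of one column [a] of a box spline matrix. *)
Definition average a g x : R := \int[mu]_(t in cube1) g (x + a * t).

Lemma mu_cube1 : mu cube1 = 1%E.
Proof.
rewrite lebesgue_measure_itv/= lte_fin ifT; last by lra.
by rewrite EFinN -EFinB; congr EFin; lra.
Qed.

Lemma integrable_cube1_cst (c : R) : mu.-integrable cube1 (EFin \o cst c).
Proof.
apply: measurable_bounded_integrable => //; first by have := ltry (1 : R); rewrite -mu_cube1.
exists `|c|; split; first exact: num_real.
by move=> N MN x _ /=; exact: ltW.
Qed.

Lemma bcont_slice a g x : bcont g -> bcont (fun t => g (x + a * t)).
Proof.
move=> gb; rewrite (_ : (fun _ => _) = g \o (fun t => a * t + x)).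
  by apply: bcont_comp => //; exact: continuous_affine.
by apply/funext => t /=; rewrite addrC.
Qed.

Lemma integrable_slice a g x : bcont g ->
  mu.-integrable cube1 (EFin \o (fun t => g (x + a * t))).
Proof.
move=> gb; rewrite (_ : _ \o _ = EFin \o (fun t => cst 1 t * g (x + a * t))).
  by apply: integrable_mul_bcont; [|exact: integrable_cube1_cst|exact: bcont_slice].
by apply/funext => t /=; rewrite mul1r.
Qed.

(** The factor 1 is the density to which [bp_functional_Rintegral] is applied. *)
Lemma averageE a g x : average a g x = \int[mu]_(t in cube1) (1 * g (x + a * t)).
Proof. by apply: eq_Rintegral => t _; rewrite mul1r. Qed.

Lemma normr_average_le a g M x : bcont g -> (forall y, `|g y| <= M) ->
  `|average a g x| <= M.
Proof.
move=> gb gM; apply: le_trans (le_normr_Rintegral _ (integrable_slice a x gb)) _ => //.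
apply: (@le_trans _ _ (\int[mu]_(t in cube1) M)).
  apply: le_Rintegral => //; last exact: integrable_cube1_cst.
  by apply: integrable_norm; exact: integrable_slice.
by rewrite Rintegral_cst// [fine _](congr1 fine mu_cube1) mulr1.
Qed.

(** Since [cube1] has finite measure, any bound of the functions is an integrable majorant; this
    gives continuity under the integral as well as the passage to the limit. *)
Lemma bp_operator_average a : bp_operator (average a).
Proof.
have avb g M : bcont g -> (forall y, `|g y| <= M) -> continuous (average a g).
  move=> gb gM x.
  apply: (@continuity_under_integral _ _ _ mu
    (fun l t => g (l + a * t)) cube1 _ (x - 1) (x + 1) _ _ (cst M)) => //.
  - by move=> l _; exact: integrable_slice.
  - apply: aeW => t _ l _ /=.
    apply: (@continuous_comp _ _ _ (fun l => l + a * t) g); last exact: gb.1.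
    by apply: cvgD; [exact: cvg_id|exact: cvg_cst].
  - exact: integrable_cube1_cst.
  - by move=> l _; apply: aeW => t _; exact: gM.
  - by rewrite inE/= in_itv/=; lra.
split.
- move=> g gb; have [gc [M gM]] := gb; split; first exact: avb gb gM.
  by exists M => x; exact: normr_average_le.
- move=> b g h gb hb; apply/funext => x; rewrite !averageE.
  have [lin _] := bp_functional_Rintegral (measurable_itv _) (integrable_cube1_cst 1).
  by rewrite -(lin b (fun t => g (x + a * t)) (fun t => h (x + a * t)))//;
     exact: bcont_slice.
- move=> g_ [gc [M gM] g0].
  have gb i : bcont (g_ i) by split => //; exists M.
  split; first by move=> i; exact: avb (gb i) (gM i).
    by exists M => i x; exact: normr_average_le.
  move=> x; under eq_fun do rewrite averageE.
  have [_ cv] := bp_functional_Rintegral (measurable_itv _) (integrable_cube1_cst 1).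
  apply: (cv (fun i t => g_ i (x + a * t))) => //; split.
  + by move=> i; exact: (bcont_slice a x (gb i)).1.
  + by exists M => i t; exact: gM.
  + by move=> t; exact: g0.
Qed.

End Averages.

(** * Uniqueness of the Fourier transform *)

Section FourierUniqueness.
Variable R : realType.
Local Notation mu := (@lebesgue_measure R).
Implicit Types (f phi : R -> R[i]) (w x : R).

Lemma bp_functionalN (m : (R -> R) -> R) g : bp_functional m -> bcont g ->
  m (fun x => - g x) = - m g.
Proof.
move=> [mlin _] gb; have cb := @bcont_cst R 0.
have := mlin 1 _ _ cb cb; rewrite mulr0 addr0 mul1r => e.
have e0 : m (fun=> 0) = 0 by apply: (@addrI _ (m (fun=> 0))); rewrite addr0 -e.
rewrite -[RHS]mulN1r -[RHS]addr0 -e0 -mlin//; congr m.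
by apply/funext => x; rewrite mulN1r addr0.
Qed.

Lemma cosNM w x : cos (- w * x) = cos (w * x).
Proof. by rewrite mulNr cosN. Qed.

Lemma sinNM w x : sin (- w * x) = - sin (w * x).
Proof. by rewrite mulNr sinN. Qed.

Lemma Cintegral_mul f phi : Cintegrable f -> bcont (cRe phi) -> bcont (cIm phi) ->
  Cintegral setT (fun x => f x * phi x) =
  (\int[mu]_x (cRe f x * cRe phi x) - \int[mu]_x (cIm f x * cIm phi x)) +i*
  (\int[mu]_x (cRe f x * cIm phi x) + \int[mu]_x (cIm f x * cRe phi x)).
Proof.
move=> [fr fi] pr pi; rewrite -RintegralB//; try exact: integrable_mul_bcont.
rewrite -RintegralD//; try exact: integrable_mul_bcont.
by congr Complex; apply: eq_Rintegral => x _; rewrite /cRe /cIm;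
  case: (f x) => a b; case: (phi x).
Qed.

(** The functional [m] is real, so comparing the frequencies [w] and [- w] separates the pairings
    with the real and imaginary parts of [f]: the latter kills all cosines and sines, and the former
    agrees with [m] on them. Then [bp_functional_eq0] applies to each. *)
Lemma fourier_unique f (m : (R -> R) -> R) : Cintegrable f -> bp_functional m ->
  (forall w, fourier f w =
     m (fun x => cos (w * x)) -i* m (fun x => sin (w * x))) ->
  forall phi, bcont (cRe phi) -> bcont (cIm phi) ->
  distr_of_fun f phi = m (cRe phi) +i* m (cIm phi).
Proof.
move=> fI mb fm phi pr pi; have [fr fi] := fI.
pose Fr g := \int[mu]_x (cRe f x * g x).
pose Fi g := \int[mu]_x (cIm f x * g x).
have Frb : bp_functional Fr by exact: bp_functional_Rintegral.
have Fib : bp_functional Fi by exact: bp_functional_Rintegral.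
have key w :
    Fr (fun x => cos (w * x)) + Fi (fun x => sin (w * x)) = m (fun x => cos (w * x)) /\
    Fi (fun x => cos (w * x)) - Fr (fun x => sin (w * x)) = - m (fun x => sin (w * x)).
  have cw := bcont_cosM w; have sw := bcont_sinM w.
  pose e x : R[i] := expi (- (w * x)).
  have e1 : cRe e = fun x => cos (w * x).
    by apply/funext => x; rewrite /cRe/= cosN.
  have e2 : cIm e = fun x => - sin (w * x).
    by apply/funext => x; rewrite /cIm/= sinN.
  have e2' : cIm e = fun x => sin (- w * x) by rewrite e2; under [RHS]eq_fun do rewrite sinNM.
  have := fm w; rewrite /fourier (@Cintegral_mul f e)//; first last.
  - by rewrite e2'; exact: bcont_sinM.
  - by rewrite e1.
  rewrite e1 e2.
  rewrite -/(Fr _) -/(Fi _) -/(Fr _) -/(Fi _) !bp_functionalN// opprK [- _ + _]addrC.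
  by case.
(* The relations [key] at [- w], where the sine terms change sign. *)
have keyN w :
    Fr (fun x => cos (w * x)) - Fi (fun x => sin (w * x)) = m (fun x => cos (w * x)) /\
    Fi (fun x => cos (w * x)) + Fr (fun x => sin (w * x)) = m (fun x => sin (w * x)).
  have cE : (fun x => cos (- w * x)) = (fun x => cos (w * x)).
    by apply/funext => x; exact: cosNM.
  have sE : (fun x => sin (- w * x)) = (fun x => - sin (w * x)).
    by apply/funext => x; exact: sinNM.
  have := key (- w); rewrite cE sE.
  have sw := bcont_sinM w.
  by rewrite !bp_functionalN// !opprK.
have Fi0 g : bcont g -> Fi g = 0.
  apply: bp_functional_eq0 => // w; have [k1 k2] := key w; have [k3 k4] := keyN w;
  lra.
have Frm g : bcont g -> Fr g = m g.
  move=> gb; pose D g := -1 * m g + Fr g.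
  have Db : bp_functional D by exact: bp_functional_lin.
  have : D g = 0.
    apply: (bp_functional_eq0 Db) gb => w; rewrite /D.
      by have [k1 _] := key w; have [k3 _] := keyN w; lra.
    by have [_ k1] := key w; have [_ k3] := keyN w; lra.
  by rewrite /D => h; lra.
rewrite /distr_of_fun Cintegral_mul// -/(Fr _) -/(Fi _) -/(Fr _) -/(Fi _).
by rewrite !Fi0// !Frm// subr0 addr0.
Qed.

End FourierUniqueness.

(** * Averages absorbing derivatives *)

Section DerivativesOfAverages.
Variable R : realType.
Local Notation mu := (@lebesgue_measure R).
Implicit Types (g h : R -> R) (a b w x : R).

Lemma is_derive_comp_affine g a b x : derivable g (a * x + b) 1 ->
  is_derive x 1 (fun y => g (a * y + b)) (a * (derive1 g) (a * x + b)).
Proof.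
move=> dg; rewrite mulrC.
apply: (@is_derive1_comp _ g (fun y => a * y + b)).
  by rewrite derive1E; exact: derivableP.
by apply: is_derive_eq; rewrite /GRing.scale/= addr0 mulr1 ?mulr0 ?addr0.
Qed.

Lemma derivable_continuous g : (forall x, derivable g x 1) -> continuous g.
Proof.
by move=> dg x; apply: differentiable_continuous; exact/derivable1_diffP.
Qed.

Lemma smooth_derive1 g : smooth g -> smooth (derive1 g).
Proof. by move=> sg k x; have := sg k.+1 x; rewrite derive1Sn. Qed.

Lemma smooth_continuous g : smooth g -> continuous g.
Proof. by move=> sg; apply: derivable_continuous => x; have := sg 0 x. Qed.

Lemma is_derive_diffq a g x : (forall y, derivable g y 1) ->
  is_derive x 1 (diffq a g) (diffq a (derive1 g) x).
Proof.
move=> dg.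
have d1 := @is_derive_comp_affine g 1 (a / 2) x (dg _).
have d2 := @is_derive_comp_affine g 1 (- (a / 2)) x (dg _).
have d3 := is_deriveZ a^-1 (is_deriveB d1 d2).
have e : diffq a g = a^-1 \*: ((fun y => g (1 * y + a / 2)) - (fun y => g (1 * y - a / 2))).
  apply/funext => y; transitivity (a^-1 * (g (1 * y + a / 2) - g (1 * y - a / 2))) => //.
  by rewrite !mul1r mulrC.
rewrite e; apply: (is_derive_eq d3).
by rewrite /diffq /GRing.scale/= !mul1r mulrC.
Qed.

Lemma derive1n_diffq a g k : smooth g ->
  derive1n k (diffq a g) = diffq a (derive1n k g).
Proof.
elim: k g => [|k IH] g sg; first by [].
rewrite !derive1Sn -IH; last exact: smooth_derive1.
congr derive1n; apply/funext => x; rewrite derive1E.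
by apply: derive_val; apply: is_derive_diffq => y; exact: (sg 0).
Qed.

Lemma smooth_diffq a g : smooth g -> smooth (diffq a g).
Proof.
move=> sg k x; rewrite derive1n_diffq//; apply: ex_derive.
by apply: is_derive_diffq => y; exact: sg.
Qed.

(** The fundamental theorem of calculus for the primitive [a^-1 * g (x + a * t)] in [t]. *)
Lemma average_derive1 a g : a != 0 -> (forall y, derivable g y 1) ->
  continuous (derive1 g) -> average a (derive1 g) = diffq a g.
Proof.
move=> a0 dg cg; apply/funext => x.
pose F t := a^-1 * g (a * t + x).
have dF (t : R) : is_derive t 1 F ((derive1 g) (x + a * t)).
  have d1 := @is_derive_comp_affine g a x t (dg _).
  have := is_deriveZ a^-1 d1.
  by rewrite /GRing.scale/= mulrA mulVf// mul1r addrC.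
have cf : continuous (fun t => (derive1 g) (x + a * t)).
  move=> t; apply: (@continuous_comp _ _ _ (fun t => x + a * t) (derive1 g)); last exact: cg.
  by apply: cvgD; [exact: cvg_cst|apply: cvgM; [exact: cvg_cst|exact: cvg_id]].
have cF : continuous F by apply: derivable_continuous => t; exact: ex_derive.
(* Adding the right endpoint leaves the integral unchanged and gives the closed interval on which
   the fundamental theorem is stated. *)
rewrite /average Rintegral_itv_bndo_bndc; last first.
  apply: (@integrableS _ _ _ mu `[- (1 / 2), 1 / 2]) => //.
    by apply: subset_itv; rewrite bnd_simp.
  apply: continuous_compact_integrable; first exact: segment_compact.
  exact: continuous_subspaceT.
rewrite /Rintegral (@continuous_FTC2 _ _ F); last first.
- by move=> t _; rewrite derive1E; exact: derive_val.
- split.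
  + by move=> t _; exact: ex_derive.
  + by apply: cvg_at_right_filter; exact: cF.
  + by apply: cvg_at_left_filter; exact: cF.
- exact: continuous_subspaceT.
- by lra.
rewrite /= /F /diffq (_ : a * (1 / 2) + x = x + a / 2); last by ring.
by rewrite (_ : a * - (1 / 2) + x = x - a / 2); ring.
Qed.

(** The innermost average absorbs the outermost derivative; the resulting difference quotient
    commutes with the remaining derivatives, so the induction hypothesis applies to [diffq a g]. *)
Lemma iter_average_derive1n a g l : a != 0 -> smooth g ->
  iter l (average a) (derive1n l g) = iter l (diffq a) g.
Proof.
move=> a0; elim: l g => [|l IH] g sg; first by [].
have dl y : derivable (derive1n l g) y 1 := sg l y.
have dSl y : derivable (derive1 (derive1n l g)) y 1.
  by have := sg l.+1 y; rewrite derive1nS.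
have dlc := derivable_continuous dSl.
rewrite iterSr [RHS]iterSr derive1nS (average_derive1 a0 dl dlc).
by rewrite -(derive1n_diffq a l sg) (IH _ (@smooth_diffq a _ sg)).
Qed.

End DerivativesOfAverages.

(** * Eigenvalues of the operators on exponentials *)

Section Symbols.
Variable R : realType.
Implicit Types (a w x : R) (c d : R[i]) (U V : (R -> R) -> R -> R).

(** States that [e^(-iwx)] is an eigenfunction with eigenvalue [c]; it is split into cosine and sine
    because [U] acts on real functions. *)
Definition symbol U w c := forall x,
  U (fun y => cos (w * y)) x -i* U (fun y => sin (w * y)) x =
  c * expi (- (w * x)).

Definition sinc (t : R) : R := if t == 0 then 1 else sin t / t.

Lemma symbol_id w : symbol id w 1.
Proof. by move=> x; rewrite mul1r /expi cosN sinN. Qed.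

(** [V] sends cosine and sine to combinations of the two with coefficients the real and imaginary
    parts of [d], so real linearity of [U] suffices. *)
Lemma symbol_comp U V w c d : bp_operator U ->
  symbol U w c -> symbol V w d -> symbol (U \o V) w (c * d).
Proof.
case=> [_ Ulin _] Uc Vd x; case: d Vd => dr di Vd.
have cb := bcont_cosM w; have sb := bcont_sinM w.
have lin (p q : R) : U (fun y => p * cos (w * y) + q * sin (w * y)) =
    (fun y => p * U (fun y => cos (w * y)) y + q * U (fun y => sin (w * y)) y).
  have sb0 : bcont (fun y => q * sin (w * y) + 0) by apply: bcont_lin => //; exact: bcont_cst.
  have e0 : U (fun=> 0) = fun=> 0.
    have := Ulin (-1) _ _ (bcont_cst 0) (bcont_cst 0).
    rewrite mulr0 addr0 => ->; apply/funext => y; by rewrite mulN1r addNr.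
  have := Ulin q _ _ sb (bcont_cst 0); rewrite e0 => e1.
  have := Ulin p _ _ cb sb0; rewrite e1.
  under eq_fun do rewrite addr0.
  by under [X in _ = X -> _]eq_fun do rewrite addr0.
have e1 : V (fun y => cos (w * y)) = (fun y => dr * cos (w * y) + di * sin (w * y)).
  apply/funext => y; have := Vd y; rewrite /expi cosN sinN; simpc.
  by case=> -> _; ring.
have e2 : V (fun y => sin (w * y)) = (fun y => - di * cos (w * y) + dr * sin (w * y)).
  apply/funext => y; have := Vd y; rewrite /expi cosN sinN; simpc.
  by case=> _ /(congr1 -%R); rewrite opprK => ->; ring.
rewrite /= e1 e2 !lin mulrAC -Uc; simpc.
by congr Complex; ring.
Qed.

Lemma symbol_iter U w c n : bp_operator U -> symbol U w c ->
  symbol (iter n U) w (c ^+ n).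
Proof.
move=> Ub Uc; elim: n => [|n IH]; first exact: symbol_id.
by rewrite exprS; exact: (symbol_comp Ub Uc IH).
Qed.

Lemma symbol_diffq a w :
  symbol (diffq a) w (0 -i* (2 / a * sin (w * a / 2))).
Proof.
move=> x; rewrite /diffq !mulrDr mulrN [w * (a / 2)]mulrA.
rewrite /expi !cosD !sinD !cosN !sinN; simpc.
by congr Complex; ring.
Qed.

(** At [w = 0] the exponential is constant. Otherwise cosine and sine are derivatives, so
    [average_derive1] turns their averages into difference quotients. *)
Lemma symbol_average a w : a != 0 -> symbol (average a) w (sinc (w * a / 2))%:C.
Proof.
move=> a0 x; have [->|w0] := eqVneq w 0.
  have averageC (k : R) : average a (fun=> k) x = k.
    by rewrite /average Rintegral_cst// [fine _](congr1 fine (mu_cube1 R)) mulr1.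
  rewrite !mul0r /sinc eqxx oppr0 expi0 mulr1.
  under eq_fun do rewrite mul0r cos0.
  under [X in _ -i* average a X x]eq_fun do rewrite mul0r sin0.
  by rewrite !averageC oppr0.
have dcos (y : R) : is_derive y 1 (fun y => w^-1 * sin (w * y)) (cos (w * y)).
  by apply: is_derive_eq; rewrite /GRing.scale/=; field.
have dsin (y : R) : is_derive y 1 (fun y => - w^-1 * cos (w * y)) (sin (w * y)).
  by apply: is_derive_eq; rewrite /GRing.scale/=; field.
have ecos : derive1 (fun y => w^-1 * sin (w * y)) = (fun y => cos (w * y)).
  by apply/funext => y; rewrite derive1E; exact: derive_val.
have esin : derive1 (fun y => - w^-1 * cos (w * y)) = (fun y => sin (w * y)).
  by apply/funext => y; rewrite derive1E; exact: derive_val.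
have acos := @average_derive1 R a _ a0 (fun y => @ex_derive _ _ _ _ _ _ _ (dcos y)).
have asin := @average_derive1 R a _ a0 (fun y => @ex_derive _ _ _ _ _ _ _ (dsin y)).
rewrite ecos in acos; rewrite esin in asin.
rewrite acos; last exact: (bcont_cosM w).1.
rewrite asin; last exact: (bcont_sinM w).1.
have h0 : w * a / 2 != 0 by rewrite !mulf_neq0// invr_eq0.
rewrite /sinc (negbTE h0) /diffq !mulrDr mulrN [w * (a / 2)]mulrA.
rewrite /expi !cosD !sinD !cosN !sinN; simpc.
by congr Complex; field; rewrite a0 w0.
Qed.

End Symbols.

(** * Box splines as iterated averages *)

Section BoxSplines.
Variable R : realType.
Local Notation mu := (@lebesgue_measure R).
Implicit Types (g : R -> R) (phi : R -> R[i]) (s : seq R) (x : R).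

Definition averages s g : R -> R := foldr (@average R) g s.

Lemma averages_cat s1 s2 g : averages (s1 ++ s2) g = averages s1 (averages s2 g).
Proof. exact: foldr_cat. Qed.

Lemma averages_nseq n a g : averages (nseq n a) g = iter n (average a) g.
Proof. by elim: n => [|n /= ->]. Qed.

(** The base point [x] is general so that the induction can absorb the first coordinate [t] into it,
    as [x + Xi 0 0 * t]. *)
Lemma cube_integralE n (Xi : 'rV[R]_n) phi x :
  cube_integral (fun u : 'cV_n => phi (x + (Xi *m u) 0 0)) =
  averages [seq Xi 0 i | i <- enum 'I_n] (cRe phi) x +i*
  averages [seq Xi 0 i | i <- enum 'I_n] (cIm phi) x.
Proof.
elim: n Xi x => [|n IH] Xi x.
  rewrite (_ : enum 'I_0 = [::]) /=; last by apply: size0nil; rewrite size_enum_ord.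
  by rewrite mxE big_ord0 addr0 /cRe /cIm; case: (phi x).
have E t (u : 'cV_n) : x + (Xi *m col_mx (t%:M : 'cV_1) u) 0 0 =
    x + Xi 0 0 * t + (rsubmx (Xi : 'rV_(1 + n)) *m u) 0 0.
  rewrite -addrA; congr (_ + _).
  transitivity ((row_mx (lsubmx (Xi : 'rV_(1 + n))) (rsubmx (Xi : 'rV_(1 + n))) *m
                 col_mx (t%:M : 'cV_1) u) 0 0); first by rewrite hsubmxK.
  rewrite mul_row_col [LHS]mxE; congr (_ + _).
  rewrite mul_mx_scalar 2!mxE mulrC; congr (Xi _ _ * t); exact: val_inj.
rewrite enum_ordSl /= -map_comp.
have -> : [seq ((fun i => Xi 0 i) \o lift ord0) i | i <- enum 'I_n] =
    [seq rsubmx (Xi : 'rV_(1 + n)) 0 i | i <- enum 'I_n].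
  by apply: eq_map => i /=; rewrite mxE; congr (Xi _ _); exact: val_inj.
rewrite /average /Cintegral; congr Complex; apply: eq_Rintegral => t _;
  rewrite /cRe /cIm.
  by under eq_fun do rewrite E; rewrite IH.
by under eq_fun do rewrite E; rewrite IH.
Qed.

Lemma box_splineE n (Xi : 'rV[R]_n) phi x :
  box_spline Xi (fun y => phi (y + x)) =
  averages [seq Xi 0 i | i <- enum 'I_n] (cRe phi) x +i*
  averages [seq Xi 0 i | i <- enum 'I_n] (cIm phi) x.
Proof.
rewrite -cube_integralE /box_spline; congr cube_integral.
by apply/funext => u; rewrite addrC.
Qed.

Lemma Xi_entries m l : [seq Xi R m l 0 i | i <- enum 'I_(m - l + 2 * l)] =
  nseq (m - l) 1 ++ nseq (2 * l) (1 / 2).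
Proof.
apply: (@eq_from_nth _ 0) => [|i].
  by rewrite size_map size_enum_ord size_cat !size_nseq.
rewrite size_map size_enum_ord => im; pose j := Ordinal im.
rewrite (nth_map j) ?size_enum_ord// (nth_ord_enum j j : nth j _ i = j).
rewrite /Xi mxE nth_cat size_nseq nth_nseq nth_nseq.
case: split_ordP => k /(congr1 val) /= ->; rewrite mxE.
  by rewrite ltn_ord.
by rewrite ltnNge leq_addr/= addKn ltn_ord.
Qed.

Lemma test_function_smooth_bcont phi : test_function phi ->
  bcont (cRe phi) /\ bcont (cIm phi).
Proof.
move=> [sr si cpt].
have bnd (f : R -> R) : continuous f -> (forall x, phi x = 0 -> f x = 0) -> bcont f.
  move=> fc f0; split=> //.
  have /compact_bounded[M [_ hM]] : compact (f @` closure [set x | phi x != 0]).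
    by apply: continuous_compact => //; exact: continuous_subspaceT.
  (* Every number above [M] is a bound on the compact closure, whence [M + 1]; the 0 serves the
     points where [phi] vanishes. *)
  exists (Num.max (M + 1) 0) => x; have [px|px] := eqVneq (phi x) 0.
    by rewrite f0// normr0 le_max lexx orbT.
  rewrite le_max; apply/orP; left; apply: hM; first by rewrite ltrDl.
  by exists x => //; exact: subset_closure.
by split; apply: bnd; try exact: smooth_continuous; move=> x; rewrite /cRe /cIm => ->.
Qed.

(** Iterated averaging for [Xi m l] with [k] averages of step [1 / 2] traded for difference
    quotients. Unlike a derivative, it acts on all bounded continuous functions. *)
Definition box_symbol_op m l k g : R -> R :=
  iter (m - l) (average 1) (iter (2 * l - k) (average (1 / 2)) (iter k (diffq (1 / 2)) g)).

Lemma bp_box_symbol_op m l k : bp_operator (box_symbol_op m l k).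
Proof.
have a1 := bp_operator_iter (m - l) (@bp_operator_average R 1).
have a2 := bp_operator_iter (2 * l - k) (@bp_operator_average R (1 / 2)).
have a3 := bp_operator_iter k (@bp_operator_diffq R (1 / 2)).
exact: (bp_operator_comp a1 (bp_operator_comp a2 a3)).
Qed.

Lemma box_spline_derive m l k phi x : (k <= 2 * l)%N ->
  smooth (cRe phi) -> smooth (cIm phi) ->
  box_spline (Xi R m l) (fun y => Cderive k phi (y + x)) =
  box_symbol_op m l k (cRe phi) x +i* box_symbol_op m l k (cIm phi) x.
Proof.
move=> kl sr si; rewrite box_splineE Xi_entries.
have E g : smooth g ->
    averages (nseq (m - l) 1 ++ nseq (2 * l) (1 / 2)) (derive1n k g) =
    box_symbol_op m l k g.
  move=> sg; rewrite averages_cat !averages_nseq -{1}(subnK kl) iterD.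
  by rewrite iter_average_derive1n// mulf_neq0// invr_eq0.
by rewrite -(E _ sr) -(E _ si).
Qed.

Lemma symbol_box m l k w : symbol (box_symbol_op m l k) w
  ((sinc (w / 2))%:C ^+ (m - l) *
   ((sinc (w / 4))%:C ^+ (2 * l - k) * (0 -i* (4 * sin (w / 4))) ^+ k)).
Proof.
have half0 : 1 / 2 != 0 :> R by rewrite mulf_neq0// invr_eq0.
have a1 := symbol_iter (m - l) (bp_operator_average 1) (symbol_average w (oner_neq0 R)).
have a2 := symbol_iter (2 * l - k) (bp_operator_average (1 / 2)) (symbol_average w half0).
have a3 := symbol_iter k (bp_operator_diffq (1 / 2)) (symbol_diffq (1 / 2) w).
have b2 := bp_operator_iter (2 * l - k) (@bp_operator_average R (1 / 2)).
have b1 := bp_operator_iter (m - l) (@bp_operator_average R 1).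
have := symbol_comp b1 a1 (symbol_comp b2 a2 a3).
rewrite mulr1 (_ : w * (1 / 2) / 2 = w / 4); last by field.
by rewrite (_ : 2 / (1 / 2) = 4) //; field.
Qed.

(** On test functions the right-hand side is a multiple of [box_symbol_op] evaluated at [x];
    [symbol_box] gives its values on exponentials, and [fourier_unique] concludes. It serves
    framelets with [k = l] and B-splines with [k = 0]. *)
Lemma fourier_box_unique m l k (c x : R) (f : R -> R[i]) : (k <= 2 * l)%N ->
  Cintegrable f ->
  (forall w, fourier f w = (c * (-1) ^+ k)%:C *
    ((sinc (w / 2))%:C ^+ (m - l) *
     ((sinc (w / 4))%:C ^+ (2 * l - k) * (0 -i* (4 * sin (w / 4))) ^+ k)) *
    expi (- (w * x))) ->
  distr_eq (distr_of_fun f)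
    (distr_scale c (distr_derive k (distr_shift x (box_spline (Xi R m l))))).
Proof.
move=> kl fI ff phi tphi; have [sr si _] := tphi.
have [br bi] := test_function_smooth_bcont tphi.
pose ev g := box_symbol_op m l k g x.
have evb : bp_functional ev by exact/bp_functional_eval/bp_box_symbol_op.
(* Split in this way, a scalar multiple of [ev] has the shape handled by [bp_functional_lin]. *)
pose m0 g := (c * (-1) ^+ k - 1) * ev g + ev g.
have m0E g : m0 g = c * (-1) ^+ k * ev g by rewrite /m0; ring.
have m0b : bp_functional m0 by exact: bp_functional_lin.
rewrite (fourier_unique fI m0b)// => [|w].
  rewrite /distr_scale /distr_derive /distr_shift box_spline_derive// !m0E.
  by rewrite -(rmorph1 (real_complex R)) -rmorphN -rmorphXn/=; simpc; rewrite !mulrA.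
rewrite ff -mulrA -symbol_box !m0E -/(ev _) -/(ev _).
by simpc.
Qed.

End BoxSplines.

(** * Affine substitution in Lebesgue integrals *)

Section AffineChangeOfVariable.
Variable R : realType.
Local Notation mu := (@lebesgue_measure R).
Implicit Types (a b x : R).

Let aff a b : R -> measurableTypeR R := fun x => a * x + b.

Let measurable_aff a b : measurable_fun setT (aff a b).
Proof. by apply: continuous_measurable_fun; exact: continuous_affine. Qed.

Local Open Scope ereal_scope.

Let push (a : {nonneg R}) b : {measure set (measurableTypeR R) -> \bar R}.
Proof. by refine (mscale a (pushforward mu (aff a%:num b))); exact: measurable_aff. Defined.

(** Both measures give half-open intervals their length, which determines Lebesgue measure. *)
Let lebesgue_measure_affine (a : {nonneg R}) b A : (0 < a%:num)%R ->
  measurable A -> mu A = push a b A.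
Proof.
move=> a0 mA; apply: lebesgue_measure_unique mA => _ [[c d]] _ <-.
rewrite /push/= /mscale/= /pushforward; move: (a%:num) a0 => {}a a0.
rewrite (_ : aff a b @^-1` _ = `](c - b) / a, (d - b) / a]%classic)%R; last first.
  apply/seteqP; split => x /=; rewrite !in_itv/= /aff -lerBrDr -ltrBlDr.
    by rewrite ltr_pdivrMr// ler_pdivlMr// ![(x * a)%R]mulrC.
  by rewrite ltr_pdivrMr// ler_pdivlMr// ![(x * a)%R]mulrC.
rewrite !lebesgue_measure_itv/= !lte_fin ltr_pM2r ?invr_gt0// ltrD2r.
case: ifPn => _; last by rewrite mule0.
by rewrite -!EFinB -EFinM; congr EFin; field; rewrite gt_eqF.
Qed.

Lemma integrable_affine a b (f : R -> R) : (0 < a)%R ->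
  mu.-integrable setT (EFin \o f) ->
  mu.-integrable setT (EFin \o (fun x => f (a * x + b)%R)) /\
  (\int[mu]_x (a * f (a * x + b)) = \int[mu]_x f x)%R.
Proof.
move=> a0 fi.
have mf : measurable_fun setT (EFin \o f) by exact: measurable_int fi.
have mg : measurable_fun setT (EFin \o (fun x => f (a * x + b)%R)).
  by apply: (measurableT_comp mf); exact: measurable_aff.
pose aN := NngNum (ltW a0).
(* The nonnegative case. It is used on the absolute value of [f] for integrability, then on the
   positive and negative parts for the integral. *)
have E (g : R -> \bar R) : measurable_fun setT g -> (forall x, 0 <= g x) ->
    \int[mu]_x g x = a%:E * \int[mu]_x g (a * x + b)%R.
  move=> mg' g0; transitivity (\int[push aN b]_x g x).
    by apply: eq_measure_integral => A mA _; exact: lebesgue_measure_affine.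
  rewrite ge0_integral_mscale//; congr (_ * _).
  by rewrite ge0_integral_pushforward//; exact: measurable_aff.
have fi' : mu.-integrable setT (EFin \o (fun x => f (a * x + b)%R)).
  apply/integrableP; split => //; move/integrableP : fi => [_].
  rewrite E//; last by apply: measurableT_comp.
  move=> h; have aV : (0 <= a^-1%:E)%E by rewrite lee_fin invr_ge0 ltW.
  have := lte_mul_pinfty aV _ h; rewrite muleA -EFinM mulVf ?gt_eqF// mul1e.
  exact.
split=> //; rewrite RintegralZl// /Rintegral.
have Ep := E _ (measurable_funepos mf) (funepos_ge0 _).
have En := E _ (measurable_funeneg mf) (funeneg_ge0 _).
have Pf := integrable_pos_fin_num measurableT fi'.
have Nf := integrable_neg_fin_num measurableT fi'.
rewrite -[EFin \o _]/((EFin \o f) \o aff a b) funepos_comp in Pf.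
rewrite -[EFin \o _]/((EFin \o f) \o aff a b) funeneg_comp in Nf.
have e : \int[mu]_x (f (a * x + b))%:E =
    \int[mu]_x (EFin \o f)^\+ (a * x + b)%R - \int[mu]_x (EFin \o f)^\- (a * x + b)%R.
  transitivity (\int[mu]_x ((EFin \o f) \o aff a b) x) => //.
  by rewrite integralE funepos_comp funeneg_comp.
rewrite e [in RHS]integralE Ep En -[in RHS]muleBr//; first last.
  by rewrite fin_num_adde_defl// fin_numN.
by rewrite [in RHS]fineM// fin_numB Pf Nf.
Qed.

End AffineChangeOfVariable.

(** * Fourier transforms of dilates and of framelets *)

Section Framelets.
Variable R : realType.
Local Notation mu := (@lebesgue_measure R).
Implicit Types (m l : nat) (w x : R) (f phi : R -> R[i]).

Lemma Cintegrable_affine (a b : R) f : 0 < a -> Cintegrable f ->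
  Cintegrable (fun x => f (a * x + b)).
Proof.
move=> a0 [fr fi].
by split; [exact: (integrable_affine b a0 fr).1|exact: (integrable_affine b a0 fi).1].
Qed.

Lemma CintegrableMl (c : R[i]) f : Cintegrable f -> Cintegrable (fun x => c * f x).
Proof.
case: c => p q [fr fi]; split.
  rewrite (_ : _ \o _ = (fun x => (p%:E * (EFin \o cRe f) x) -
                                  (q%:E * (EFin \o cIm f) x))%E).
    by apply: integrableB => //; exact: integrableZl.
  by apply/funext => x /=; rewrite -!EFinM -EFinB /cRe /cIm; case: (f x).
rewrite (_ : _ \o _ = (fun x => (p%:E * (EFin \o cIm f) x) +
                                (q%:E * (EFin \o cRe f) x))%E).
  by apply: integrableD => //; exact: integrableZl.
by apply/funext => x /=; rewrite -!EFinM -EFinD /cRe /cIm; case: (f x).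
Qed.

Lemma CintegralMl (c : R[i]) f : Cintegrable f ->
  Cintegral setT (fun x => c * f x) = c * Cintegral setT f.
Proof.
case: c => p q [fr fi]; have Zi (k : R) (g : R -> R) : mu.-integrable setT (EFin \o g) ->
    mu.-integrable setT (EFin \o (fun x => k * g x)).
  move=> gi; rewrite (_ : _ \o _ = (fun x => k%:E * (EFin \o g) x)%E).
    exact: integrableZl.
  by apply/funext => x /=; rewrite -EFinM.
rewrite /Cintegral; simpc; rewrite -!RintegralZl// -RintegralB -?RintegralD//;
  try exact: Zi.
by congr Complex; apply: eq_Rintegral => x _; rewrite /cRe /cIm; case: (f x).
Qed.

Lemma Cintegral_affine (a b : R) f : 0 < a -> Cintegrable f ->
  Cintegral setT (fun x => a%:C * f (a * x + b)) = Cintegral setT f.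
Proof.
move=> a0 fI; have [gr gi] := Cintegrable_affine b a0 fI; have [fr fi] := fI.
rewrite CintegralMl; last exact: Cintegrable_affine.
rewrite /Cintegral -(integrable_affine b a0 fr).2 -(integrable_affine b a0 fi).2.
by simpc; rewrite !RintegralZl.
Qed.

Lemma Cintegrable_mul_expi f w : Cintegrable f ->
  Cintegrable (fun x => f x * expi (- (w * x))).
Proof.
move=> [fr fi].
have cb : bcont (fun x => cos (- w * x)) := bcont_cosM (- w).
have sb : bcont (fun x => sin (- w * x)) := bcont_sinM (- w).
split.
  rewrite (_ : _ \o _ = (fun x => (EFin \o (fun x => cRe f x * cos (- w * x))%R) x -
                                  (EFin \o (fun x => cIm f x * sin (- w * x))%R) x)%E).
    by apply: integrableB => //; exact: integrable_mul_bcont.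
  by apply/funext => x /=; rewrite -EFinB /cRe /cIm !mulNr; case: (f x).
rewrite (_ : _ \o _ = (fun x => (EFin \o (fun x => cRe f x * sin (- w * x))%R) x +
                                (EFin \o (fun x => cIm f x * cos (- w * x))%R) x)%E).
  by apply: integrableD => //; exact: integrable_mul_bcont.
by apply/funext => x /=; rewrite -EFinD /cRe /cIm !mulNr; case: (f x).
Qed.

(** Substitution of [a x - b], with [a] as the Jacobian, after splitting the phase:
    [w x = w b / a + (w / a) (a x - b)]. *)
Lemma fourier_scale f (c a b : R) w : 0 < a -> Cintegrable f ->
  fourier (fun x => (c * a)%:C * f (a * x - b)) w =
  c%:C * (expi (- (w * (b / a))) * fourier f (w / a)).
Proof.
move=> a0 fI.
have hI := Cintegrable_mul_expi (w / a) fI.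
rewrite /fourier -(Cintegral_affine (- b) a0 hI) mulrA.
rewrite -CintegralMl; last first.
  apply: CintegrableMl.
  exact: (@Cintegrable_affine a (- b) (fun y => f y * expi (- (w / a * y)))).
congr (Cintegral setT); apply/funext => x.
rewrite rmorphM/= (_ : - (w * x) = - (w * (b / a)) - w / a * (a * x - b)).
  by rewrite expiD; ring.
by field; rewrite gt_eqF.
Qed.

Lemma derive1n_near0 k (g : R -> R) (U : set R) : open U ->
  (forall x, U x -> g x = 0) -> forall x, U x -> derive1n k g x = 0.
Proof.
move=> oU; elim: k g => [|k IH] g g0; first exact: g0.
move=> x Ux; rewrite derive1Sn; apply: IH => // {Ux}x Ux.
rewrite derive1E (near_eq_derive (g := cst 0)); first exact: derive_val.
by near=> y; apply: g0; near: y; exact: open_nbhs_nbhs.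
Unshelve. all: by end_near. Qed.

(** Off the closed support of [phi] all derivatives vanish, so the support of the derivative is a
    closed subset of a compact set. *)
Lemma test_function_Cderive k phi : test_function phi ->
  test_function (Cderive k phi).
Proof.
move=> [sr si cpt].
have sm (g : R -> R) : smooth g -> smooth (derive1n k g).
  elim: k g => [//|k IH] g sg; rewrite derive1Sn; apply: IH; exact: smooth_derive1.
split; [exact: sm|exact: sm|].
apply: (subclosed_compact _ cpt); first exact: closed_closure.
rewrite [X in _ `<=` X](iffLR (closure_id _) (@closed_closure _ _)).
apply: closureS => x /=; apply: contra_neqP => nx.
have oU : open (~` closure [set x | phi x != 0]) by apply: closed_openC; exact: closed_closure.
have p0 y : (~` closure [set x | phi x != 0]) y -> phi y = 0.
  by move=> ny; apply: contra_notP ny => /eqP py; exact: subset_closure.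
by rewrite /Cderive !(derive1n_near0 _ oU)// => y /p0; rewrite /cRe /cIm => ->.
Qed.

(** The double angle formula for sine at [w / 4]. *)
Lemma sinc_half w : sin (w / 4) != 0 ->
  sinc (w / 2) = cos (w / 4) * sinc (w / 4).
Proof.
move=> s0; have w0 : w != 0 by apply: contraNneq s0 => ->; rewrite mul0r sin0.
rewrite /sinc !mulf_eq0 (negbTE w0) !invr_eq0 !pnatr_eq0/=.
rewrite [X in sin X / (w / 2)](_ : _ = w / 4 + w / 4); last by field.
by rewrite sinD; field; rewrite w0.
Qed.

(** By [sinc_half] the [m - l] unit columns supply the powers of cosine. The signs [(-1)^l] from the
    distributional derivative and from [(-i)^l = (-1)^l i^l] cancel, and so do the powers [4^l]. *)
Lemma fourier_framelet_box m l w : (1 <= l <= m)%N ->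
  (0 +i* 1) ^+ l * expi (- (w * j_ R m / 2)) * (Num.sqrt ('C(m, l)%:R : R))%:C *
    (cos (w / 4) ^+ (m - l) * sin (w / 4) ^+ (m + l) / (w / 4) ^+ m)%:C =
  ((Num.sqrt ('C(m, l)%:R) * (1 / 4 ^+ l)) * (-1) ^+ l)%:C *
    ((sinc (w / 2))%:C ^+ (m - l) *
     ((sinc (w / 4))%:C ^+ (2 * l - l) * (0 -i* (4 * sin (w / 4))) ^+ l)) *
    expi (- (w * (j_ R m / 2))).
Proof.
case/andP=> l1 lm; rewrite [w * (j_ R m / 2)]mulrA mul2n -addnn addnK.
have -> : (0 -i* (4 * sin (w / 4))) ^+ l =
    (0 +i* 1) ^+ l * ((-1) ^+ l * 4 ^+ l * sin (w / 4) ^+ l)%:C :> R[i].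
  rewrite (_ : 0 -i* (4 * sin (w / 4)) = (0 +i* 1) * (- 1 * 4 * sin (w / 4))%:C).
    by rewrite exprMn -rmorphXn/= !exprMn.
  by simpc; congr Complex; ring.
rewrite -!(rmorphXn (real_complex R))/=.
set I := (0 +i* 1) ^+ l; set e := expi _; set s := Num.sqrt _.
transitivity (I * e * (s * (cos (w / 4) ^+ (m - l) *
    sin (w / 4) ^+ (m + l) / (w / 4) ^+ m))%:C).
  by rewrite !rmorphM/=; ring.
transitivity (I * e * (s * (1 / 4 ^+ l) * (-1) ^+ l *
   (sinc (w / 2) ^+ (m - l) * (sinc (w / 4) ^+ l *
     ((-1) ^+ l * 4 ^+ l * sin (w / 4) ^+ l))))%:C); last by rewrite !rmorphM/=; ring.
congr (_ * _%:C); rewrite -!mulrA; congr (s * _).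
(* If the sine vanishes, in particular at [w = 0] where division by 0 gives 0, both sides are 0
   because [l >= 1]. *)
have [s0|s0] := eqVneq (sin (w / 4)) 0.
  by rewrite s0 !expr0n addn_eq0 (gtn_eqF l1) andbF/= !(mulr0, mul0r).
have w0 : w != 0 by apply: contraNneq s0 => ->; rewrite mul0r sin0.
have e1 : (-1) ^+ l * (-1) ^+ l = 1 :> R by rewrite -exprMn mulrNN mulr1 expr1n.
have e4 : 4 ^+ l != 0 :> R by rewrite expf_neq0.
rewrite sinc_half// [(cos _ * _) ^+ _]exprMn /sinc mulf_eq0 (negbTE w0) invr_eq0 pnatr_eq0/=.
have e5 : (sin (w / 4) / (w / 4)) ^+ (m - l) * (sin (w / 4) / (w / 4)) ^+ l *
    sin (w / 4) ^+ l = sin (w / 4) ^+ (m + l) / (w / 4) ^+ m.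
  by rewrite -exprD subnK// expr_div_n exprD mulrAC.
rewrite -e5 mul1r; move: e1 (mulVf e4) => {e4 e5}.
move: (cos _ ^+ _) (sin (w / 4) ^+ l) => c v.
move: (_ ^+ (m - l)) ((sin _ / _) ^+ l) => t u.
move: (4 ^+ l) ((-1) ^+ l) => p d dd qp.
transitivity (c * (t * u * v) * (d * d) * (p^-1 * p)); last by ring.
by rewrite dd qp !mulr1 mulrA.
Qed.

End Framelets.

(** * The identities for framelets and B-splines *)

Lemma framelet_box (R : realType) m l (psi : R -> R[i]) : (1 <= l <= m)%N ->
  is_framelet m l psi ->
  distr_eq (distr_of_fun psi)
    (distr_scale (Num.sqrt ('C(m, l)%:R) * (1 / 4 ^+ l))
       (distr_derive l (distr_shift (j_ R m / 2) (box_spline (Xi R m l))))).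
Proof.
move=> lm [psiI hpsi]; apply: fourier_box_unique => // [|w].
  by rewrite mul2n -addnn leq_addr.
by rewrite hpsi; exact: fourier_framelet_box.
Qed.

(** For [l = m] all [2 m] columns equal [1 / 2], so the transform is a power of [sinc (w / 4)], that
    of [B] at [w / 2]. The factor 2 is the Jacobian of the dilation. *)
Lemma bspline_box (R : realType) m (B : R -> R[i]) : is_bspline (2 * m) B ->
  distr_eq (distr_of_fun (fun x => (2 / 4 ^+ m)%:C * B (2 * x - j_ R m)))
    (distr_scale (4 ^- m)
       (distr_derive 0%N (distr_shift (j_ R m / 2) (box_spline (Xi R m m))))).
Proof.
case=> BI hB; have two0 : 0 < 2 :> R by [].
rewrite [2 / _]mulrC; apply: fourier_box_unique => // [|w].
  by apply: CintegrableMl; exact: Cintegrable_affine.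
rewrite fourier_scale// hB subnn subn0 !expr0 !mulr1 mul1r.
rewrite -[RHS]mulrA; congr (_ * _); rewrite mulrC; congr (_ * _).
rewrite rmorphXn/=; congr (_%:C ^+ _).
rewrite /sinc mulf_eq0 invr_eq0 pnatr_eq0 orbF (_ : w / 2 / 2 = w / 4); last by field.
by rewrite mulf_eq0 invr_eq0 pnatr_eq0 orbF.
Qed.

Theorem theorem3 (R : realType) (m : nat) (hm : (1 <= m)%N) :
  (forall (l : nat) (psi : R -> R[i]),
     (1 <= l <= m)%N -> is_framelet m l psi ->
     distr_eq (distr_of_fun psi)
       (distr_scale (Num.sqrt ('C(m, l)%:R) * (1 / 4 ^+ l))
          (distr_derive l (distr_shift (j_ R m / 2) (box_spline (Xi R m l)))))) /\
  (forall psi B : R -> R[i],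
     is_framelet m m psi -> is_bspline (2 * m) B ->
     distr_eq (distr_of_fun psi)
       (distr_derive m
          (distr_of_fun (fun x => (2 / 4 ^+ m)%:C * B (2 * x - j_ R m))))).
Proof.
split=> [l psi|psi B psiF BB phi tphi]; first exact: framelet_box.
rewrite (framelet_box _ psiF tphi) ?hm ?leqnn// /distr_derive.
rewrite (bspline_box BB (test_function_Cderive m tphi)).
rewrite /distr_scale /distr_derive binn sqrtr1 !mul1r mulrCA.
(* The remaining arguments agree by computation, since [Cderive 0] leaves [Cderive m phi]
   unchanged. *)
congr (_ * (_ * distr_shift _ _ _)).
Qed.
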